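(* Let $\Gamma$ be a finitely generated infinite group. Then there is a coloring of the elements of $\Gamma$ with two colors such that the identity map is the only group endomorphism $\phi:\Gamma\to\Gamma$ satisfying $c(\phi(g)) = c(g)$ for all $g \in \Gamma$. In other words, finitely generated infinite groups are endomorphism $2$-distinguishable.
   Context: Here endomorphisms are group homomorphisms $\Gamma \to \Gamma$. *)

(* Defs.v *)
(* MathComp world, with the classical sets of MathComp-Analysis. *)
From mathcomp Require Import all_boot.
From mathcomp Require Import boolp classical_sets functions cardinality.

Set Implicit Arguments.
Unset Strict Implicit.
Unset Printing Implicit Defensive.

Local Open Scope classical_set_scope.
Local Open Scope group_scope.

(* [group_closed] expects a boolean collective predicate; [mem H] is the
   classical decision of membership in H. *)
Definition gen_subgroup (G : groupType) (A : set G) : set G :=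
  smallest [set H : set G | group_closed (mem H)] A.

Definition finitely_generated (G : groupType) : Prop :=
  exists2 A : set G, finite_set A & gen_subgroup A = [set: G].

(* Between groups, [UMagmaMorphism.type] is the type of group
   homomorphisms. *)
Definition endo_distinguishable (k : nat) (G : groupType) : Prop :=
  exists c : G -> 'I_k,
    forall phi : UMagmaMorphism.type G G,
      (forall g : G, c (phi g) = c g) <-> phi =1 id.

(* Main.v *)
Require Import Defs.
From mathcomp Require Import all_boot.
From mathcomp Require Import boolp classical_sets functions cardinality.

(** A finitely generated group is countable, hence has only countably many
    endomorphisms. The points moved by an endomorphism other than the identity
    form the complement of a proper subgroup, which is infinite. One can
    therefore treat these endomorphisms one at a time, each time choosing a
    moved point [x] that has not been colored yet and giving it the color
    opposite to that of its image [phi x]; only finitely many points are ever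
    colored at a given stage, and [phi] need not be injective. *)

Local Open Scope classical_set_scope.

Lemma countable_separating_coloring (T : choiceType) (F : set (T -> T)) :
    countable F -> (forall f, F f -> infinite_set [set x | f x <> x]) ->
  exists c : T -> bool, forall f, F f -> exists x, c (f x) != c x.
Proof.
move=> /countable_injP[code code_inj] F_moves.
have [->|/set0P[f0 Ff0]] := eqVneq F set0; first by exists xpredT.
(* [e] enumerates [F] along [code], with [f0] as the default at numbers that are not codes. *)
have /choice[e eP] n : exists f, F f /\ forall f', F f' -> code f' = n -> f' = f.
  have [[f [Ff fn]]|nf] := pselect (exists f, F f /\ code f = n).
    by exists f; split=> // f' Ff' f'n; apply: code_inj; rewrite ?inE ?fn.
  by exists f0; split=> // f' Ff' f'n; case: nf; exists f'.
have /choice[pick pickP] (ns : nat * seq T) :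
    exists x, e ns.1 x <> x /\ x \notin ns.2.
  have := infinite_setD (F_moves _ (eP ns.1).1) (finite_seq ns.2).
  by move=> /infinite_setN0[x [ex /negP xs]]; exists x.
(* The list holds the points whose color is final. The image [e m x] joins it with the color it has
   so far, so that no later stage can recolor it and spoil the inequality at [x]. *)
pose fix stage n : seq T * (T -> bool) :=
  if n is m.+1 then
    let: (s, c) := stage m in let x := pick (m, s) in
    ([:: x, e m x & s], fun y => if y == x then ~~ c (e m x) else c y)
  else ([::], xpredT).
have stageS n x : x \in (stage n).1 ->
    x \in (stage n.+1).1 /\ (stage n.+1).2 x = (stage n).2 x.
  move=> /=; case: (stage n) => s c /= xs; rewrite !inE xs !orbT; split=> //.
  case: eqP => // xp; have /= := (pickP (n, s)).2.
  by rewrite -xp xs.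
have stageD n m x : x \in (stage n).1 ->
    x \in (stage (m + n)).1 /\ (stage (m + n)).2 x = (stage n).2 x.
  move=> xn; elim: m => [|m [xm IH]]; first by [].
  by rewrite addSn -IH; apply: stageS.
(* The limit coloring; a point that enters no list gets [false]. *)
pose c x := `[< exists n, x \in (stage n).1 /\ (stage n).2 x >].
have cE n x : x \in (stage n).1 -> c x = (stage n).2 x.
  move=> xn; apply/asboolP/idP => [[m [xm]]|]; last by exists n.
  by rewrite -(stageD m n x xm).2 addnC (stageD n m x xn).2.
exists c => f Ff; rewrite ((eP (code f)).2 _ Ff erefl).
move: (code f) => n; exists (pick (n, (stage n).1)).
have := cE n.+1; have := pickP (n, (stage n).1).
rewrite /=; case: (stage n) => s d /= [/eqP/negPf mv _] cE'.
by rewrite !cE' ?inE ?eqxx ?orbT // mv; case: (d _).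
Qed.

Local Open Scope group_scope.

(** The values of words in the generators and their inverses form a subgroup, and there are
    countably many words. *)
Lemma gen_subgroup_countable {G : groupType} (A : set G) :
  finite_set A -> countable (gen_subgroup A).
Proof.
move=> /finite_seqP[s ->].
pose ev (w : seq (nat * bool)) :=
  \prod_(i <- w) (if i.2 then (nth 1 s i.1)^-1 else nth 1 s i.1).
have evV w : exists w', ev w' = (ev w)^-1.
  elim: w => [|[i b] w [w' IH]]; first by exists [::]; rewrite /ev big_nil invg1.
  exists (w' ++ [:: (i, ~~ b)]).
  rewrite /ev big_cat -/(ev w') IH big_seq1 big_cons invgM /=.
  by case: b => //=; rewrite invgK.
apply: (@sub_countable _ _ _ (range ev)); last first.
  exact: sub_countable (card_image_le _ _) _.
apply: subset_card_le; apply: smallest_sub.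
  split; first by rewrite inE; exists [::] => //; rewrite /ev big_nil.
  move=> x y; rewrite !inE => -[u _ <-] [v _ <-].
  have [v' <-] := evV v; exists (u ++ v') => //.
  by rewrite /ev big_cat.
move=> x /= xs; exists [:: (index x s, false)] => //.
by rewrite /ev big_seq1 /= nth_index.
Qed.

(** The equalizer of two endomorphisms is a subgroup. *)
Lemma eq_endo_gen {G : groupType} (A : set G) (f g : UMagmaMorphism.type G G) :
  gen_subgroup A = [set: G] -> {in A, f =1 g} -> f =1 g.
Proof.
move=> genA fg x; have : gen_subgroup A x by rewrite genA.
apply: (@smallest_sub _ _ _ [set x | f x = g x]) => [|y Ay]; last first.
  by apply: fg; rewrite inE.
split; first by rewrite inE /= !gmulf1.
by move=> y z; rewrite !inE /= !gmulfF => -> ->.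
Qed.

(** An endomorphism is determined by its values on a finite generating list, a finite sequence over
    a countable set. *)
Lemma endo_countable {G : groupType} :
  finitely_generated G -> countable (range (@UMagmaMorphism.sort G G)).
Proof.
move=> [A finA genA]; have := gen_subgroup_countable A finA.
rewrite genA => /countable_injP[code code_inj].
have /finite_seqP[s As] := finA.
apply/countable_injP; exists (fun f => pickle [seq code (f x) | x <- s]).
move=> _ _ /set_mem[f _ <-] /set_mem[g _ <-] /(pcan_inj pickleK) fg.
apply/funext/(eq_endo_gen A f g genA) => x; rewrite As inE /= => xs.
by apply: code_inj; rewrite ?inE //; apply: (eq_in_map _ _ _).2 fg _ xs.
Qed.

(* If the moved set [M] were finite and [k] is moved, then left translation by
   [k] maps the fixed subgroup into [M], so that subgroup is finite too. *)
Lemma endo_motion_infinite {G : groupType} (f : UMagmaMorphism.type G G) :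
    infinite_set [set: G] -> ~ f =1 id ->
  infinite_set [set x | f x <> x].
Proof.
move=> infG /existsNP[k fk] finM; apply: infG.
have fixfin : finite_set [set x | f x = x].
  apply: sub_finite_set (finite_image (fun y => k^-1 * y) finM) => x /= fx.
  exists (k * x); last by rewrite mulKg.
  by rewrite /= gmulfM fx => /mulIg.
suff -> : [set: G] = [set x | f x = x] `|` [set x | f x <> x].
  by rewrite finite_setU.
by apply/seteqP; split=> // x _; apply: EM.
Qed.

Local Close Scope group_scope.

Theorem theorem6 (G : groupType) (G_fg : finitely_generated G)
    (G_inf : infinite_set [set: G]) :
  endo_distinguishable 2 G.
Proof.
pose F := range (@UMagmaMorphism.sort G G) `\ id.
have [||c cP] := countable_separating_coloring G F.
- apply: sub_countable (endo_countable G_fg).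
  exact: subset_card_le (@subDsetl _ _ _).
- move=> _ [[f _ <-] fid]; apply: endo_motion_infinite => // f1.
  exact/fid/funext.
exists (fun x => inord (c x)) => phi; split=> [cphi|phi1 g]; last first.
  by rewrite phi1.
apply: contrapT => phi1.
have [|x /eqP[]] := cP phi; first by split=> // fE; apply: phi1; rewrite fE.
(* Booleans read as numbers are below 2, so [inord] keeps the two colors apart. *)
have /(congr1 (@nat_of_ord 2)) := cphi x.
by rewrite !inordK; do 2?case: (c _).
Qed.
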